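(* Let $n,m$ be positive integers with gcd $d$, and let $n':=\frac{n}{d}$, $m':=\frac{m}{d}$. Let $K=(k_1,\dots,k_d)\in(\mathbb{N}_{\geqslant 2}\cup\{\infty\})^d$ and $b,c\in\mathbb{N}_{\geqslant 2}\cup\{\infty\}$. Write $d\cdot 1$ for the $d$-tuple $(1,\dots,1)$. There are reflection isomorphisms \begin{itemize} \item $\mathcal{B}^*_*(n,m;K,b,c)\cong_{\mathrm{Ref}}J\begin{pmatrix}K&bn'&cm'\\ d\cdot 1&n'&m'\end{pmatrix}$, \item $\mathcal{B}^*(n,m;K,c)\cong_{\mathrm{Ref}}J\begin{pmatrix}K&n'&cm'\\ d\cdot 1&n'&m'\end{pmatrix}$, \item $\mathcal{B}_*(n,m;K,b)\cong_{\mathrm{Ref}}J\begin{pmatrix}K&bn'&m'\\ d\cdot 1&n'&m'\end{pmatrix}$, \item $\mathcal{B}(n,m;K)\cong_{\mathrm{Ref}}J\begin{pmatrix}K&n'&m'\\ d\cdot 1&n'&m'\end{pmatrix}$. \end{itemize}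
   Context: Generalized $J$-groups: for a tuple $K=(k_1,\dots,k_p)$ with entries in $\mathbb{N}_{\geqslant 1}\cup\{\infty\}$, let $J(K)=\langle s_1,\dots,s_p\mid s_1s_2\cdots s_p=s_2\cdots s_ps_1=\cdots=s_ps_1\cdots s_{p-1},\ s_i^{k_i}=1 \text{ for all } i \text{ with } k_i<\infty\rangle$ (entries equal to $1$ may be deleted). If $K'=(k'_1,\dots,k'_p)$ are positive integers with $k'_i\mid k_i$ (every positive integer divides $\infty$, and $\infty\cdot n=\infty$), then $J\binom{K}{K'}$ is the normal closure of $\{s_1^{k'_1},\dots,s_p^{k'_p}\}$ in $J(K)$; the top row of a matrix gives $K$ and the bottom row gives $K'$. Its reflections are the conjugates in $J(K)$ of the powers of the $s_i^{k'_i}$ that are different from $1$. $J$-braid groups: for positive integers $n,m$ write $m=qn+r$ with $q\geqslant 0$, $0\leqslant r\leqslant n-1$. The group $\mathcal{B}^*_*(n,m)$ has generators $x_1,\dots,x_n,y,z$ and, with $\delta:=x_1\cdots x_ny$ (products over empty ranges being $1$), relations: $x_1\cdots x_nyz=zx_1\cdots x_ny$; $x_{i+1}\cdots x_nyz\delta^{q-1}x_1\cdots x_{i+r}=x_i\cdots x_nyz\delta^{q-1}x_1\cdots x_{i+r-1}$ for $1\leqslant i\leqslant n-r$; $x_{i+1}\cdots x_nyz\delta^{q}x_1\cdots x_{i+r-n}=x_i\cdots x_nyz\delta^{q}x_1\cdots x_{i+r-n-1}$ for $n-r+1\leqslant i\leqslant n$. The groups $\mathcal{B}^*(n,m)$,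 $\mathcal{B}_*(n,m)$, $\mathcal{B}(n,m)$ are the quotients of $\mathcal{B}^*_*(n,m)$ by the normal closures of $y$, of $z$, and of $\{y,z\}$ respectively. Torsion quotients: with $d=\gcd(n,m)$, $\mathcal{B}^*_*(n,m;K,b,c)$ (resp. $\mathcal{B}^*(n,m;K,c)$, $\mathcal{B}_*(n,m;K,b)$, $\mathcal{B}(n,m;K)$) is the quotient of $\mathcal{B}^*_*(n,m)$ (resp. $\mathcal{B}^*(n,m)$, $\mathcal{B}_*(n,m)$, $\mathcal{B}(n,m)$) by the normal closure of $x_1^{k_1},\dots,x_d^{k_d}$, together with $y^b,z^c$ (resp. $z^c$; $y^b$; nothing), where an exponent $\infty$ means that the relation is omitted. The reflections of a torsion quotient are the nontrivial (i.e. $\neq 1$) powers of conjugates of the images of the generators. A reflection isomorphism ($\cong_{\mathrm{Ref}}$) is a group isomorphism mapping the set of reflections of the source bijectively onto the set of reflections of the target. *)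

(* Defs.v *)
From HB Require Import structures.
From mathcomp Require Import all_boot all_order ssralg ssrint.
From mathcomp Require Import boolp classical_sets.

Set Implicit Arguments.
Unset Strict Implicit.
Unset Printing Implicit Defensive.

Local Open Scope classical_set_scope.
Local Open Scope quotient_scope.
Local Open Scope group_scope.

Definition gexpz (G : groupType) (g : G) (k : int) : G :=
  match k with Posz j => g ^+ j | Negz j => g ^- j.+1 end.

Definition normal_subgroup (G : groupType) (N : set G) : Prop :=
  [/\ N 1,
      forall g h, N g -> N h -> N (g * h),
      forall g, N g -> N g^-1
    & forall g h, N g -> N (g ^ h)].

Definition normal_closure (G : groupType) (S : set G) : set G :=
  smallest (@normal_subgroup G) S.

Lemma normal_closure_normal (G : groupType) (S : set G) :
  normal_subgroup (normal_closure S).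
Proof.
split=> [|g h Ng Nh|g Ng|g h Ng] N [nN sN]; case: (nN) => N1 NM NV NJ //.
- by apply: NM; [apply: Ng|apply: Nh].
- by apply: NV; apply: Ng.
- by apply: NJ; apply: Ng.
Qed.

Section NormalClosureGroup.
Variables (G : groupType) (S : set G).

Definition ncl_group : Type := {g : G | g \in normal_closure S}.

HB.instance Definition _ := SubChoice.on ncl_group.

Lemma normal_closure_group_closed :
  group_closed [pred g | g \in normal_closure S].
Proof.
have [N1 NM NV _] := normal_closure_normal S.
split=> [|g h /set_mem Ng /set_mem Nh]; apply/mem_set => //.
by apply: NM => //; apply: NV.
Qed.

HB.instance Definition _ :=
  SubChoice_isSubGroup.Build G _ ncl_group normal_closure_group_closed.

End NormalClosureGroup.

(* The quotient of [G] by the normal closure of [S]. *)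
Section Quotient.
Variables (G : groupType) (S : set G).

Definition quo_rel (g h : G) : bool := `[< normal_closure S (g / h) >].

Lemma quo_rel_refl : reflexive quo_rel.
Proof.
by move=> g; apply/asboolP; rewrite mulgV; case: (normal_closure_normal S).
Qed.

Lemma quo_rel_sym : symmetric quo_rel.
Proof.
have [_ _ NV _] := normal_closure_normal S.
by move=> g h; apply/asboolP/asboolP => /NV; rewrite invgF.
Qed.

Lemma quo_rel_trans : transitive quo_rel.
Proof.
have [_ NM _ _] := normal_closure_normal S.
move=> h g k /asboolP Hgh /asboolP Hhk; apply/asboolP.
by have := NM _ _ Hgh Hhk; rewrite mulgA mulgVK.
Qed.

Canonical quo_equiv :=
  EquivRel quo_rel quo_rel_refl quo_rel_sym quo_rel_trans.

Definition quo : Type := {eq_quot quo_equiv}.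

HB.instance Definition _ := Choice.on quo.
HB.instance Definition _ := EqQuotient.on quo.

Definition quo_proj (g : G) : quo := \pi_quo g.

Definition quo_one : quo := quo_proj 1.
Definition quo_mul (a b : quo) : quo := quo_proj (repr a * repr b).
Definition quo_inv (a : quo) : quo := quo_proj (repr a)^-1.

Lemma quo_projP (g h : G) :
  quo_proj g = quo_proj h <-> normal_closure S (g / h).
Proof.
split=> [/eqquotP/asboolP//|H]; apply/eqquotP; exact/asboolP.
Qed.

Lemma quo_projK (a : quo) : quo_proj (repr a) = a.
Proof. exact: reprK. Qed.

Lemma quo_projM (g h : G) :
  quo_proj (g * h) = quo_mul (quo_proj g) (quo_proj h).
Proof.
have [_ NM _ NJ] := normal_closure_normal S.
set g' := repr (quo_proj g); set h' := repr (quo_proj h).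
have /quo_projP Hg : quo_proj g = quo_proj g' by rewrite quo_projK.
have /quo_projP Hh : quo_proj h = quo_proj h' by rewrite quo_projK.
apply/quo_projP; rewrite -/g' -/h'.
have := NM _ _ (NJ _ g^-1 Hh) Hg.
by rewrite conjgE invgK invgM !mulgA mulgVK.
Qed.

Lemma quo_projV (g : G) : quo_proj g^-1 = quo_inv (quo_proj g).
Proof.
have [_ _ NV NJ] := normal_closure_normal S.
set g' := repr (quo_proj g).
have /quo_projP Hg : quo_proj g' = quo_proj g by rewrite quo_projK.
apply/quo_projP; rewrite -/g' invgK.
by have := NJ _ g Hg; rewrite conjgE mulgVK.
Qed.

Lemma quo_mulA : associative quo_mul.
Proof.
move=> a b c; rewrite -(quo_projK a) -(quo_projK b) -(quo_projK c).
by rewrite -!quo_projM mulgA.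
Qed.

Lemma quo_mul1 : left_id quo_one quo_mul.
Proof. by move=> a; rewrite -(quo_projK a) -quo_projM mul1g. Qed.

Lemma quo_mulr1 : right_id quo_one quo_mul.
Proof. by move=> a; rewrite -(quo_projK a) -quo_projM mulg1. Qed.

Lemma quo_mulV : left_inverse quo_one quo_inv quo_mul.
Proof. by move=> a; rewrite -(quo_projK a) -quo_projV -quo_projM mulVg. Qed.

Lemma quo_mulrV : right_inverse quo_one quo_inv quo_mul.
Proof. by move=> a; rewrite -(quo_projK a) -quo_projV -quo_projM mulgV. Qed.

HB.instance Definition _ :=
  isGroup.Build quo quo_mulA quo_mul1 quo_mulr1 quo_mulV quo_mulrV.

HB.instance Definition _ := isMultiplicative.Build G quo quo_proj quo_projM.

End Quotient.

(* The free group on [A]: words in the letters [(a, false)] (standing for a)  *)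
(* and [(a, true)] (standing for its inverse), up to cancellation.            *)
Section FreeGroup.
Variable A : choiceType.

Notation word := (seq (A * bool)).

Inductive free_eq : word -> word -> Prop :=
  | free_eq_refl u : free_eq u u
  | free_eq_sym u v : free_eq u v -> free_eq v u
  | free_eq_trans u v w : free_eq u v -> free_eq v w -> free_eq u w
  | free_eq_cancel u v a e :
      free_eq (u ++ [:: (a, e); (a, ~~ e)] ++ v) (u ++ v).

Definition free_rel (u v : word) : bool := `[< free_eq u v >].

Lemma free_rel_refl : reflexive free_rel.
Proof. by move=> u; apply/asboolP; apply: free_eq_refl. Qed.

Lemma free_rel_sym : symmetric free_rel.
Proof. by move=> u v; apply/asboolP/asboolP; apply: free_eq_sym. Qed.

Lemma free_rel_trans : transitive free_rel.
Proof.
move=> v u w /asboolP Huv /asboolP Hvw; apply/asboolP.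
exact: free_eq_trans Huv Hvw.
Qed.

Canonical free_equiv :=
  EquivRel free_rel free_rel_refl free_rel_sym free_rel_trans.

Definition free_group : Type := {eq_quot free_equiv}.

HB.instance Definition _ := Choice.on free_group.
HB.instance Definition _ := EqQuotient.on free_group.

Definition free_proj (u : word) : free_group := \pi_free_group u.

Definition inv_word (u : word) : word := rev [seq (l.1, ~~ l.2) | l <- u].

Definition free_one : free_group := free_proj [::].
Definition free_mul (a b : free_group) : free_group :=
  free_proj (repr a ++ repr b).
Definition free_inv (a : free_group) : free_group :=
  free_proj (inv_word (repr a)).

Lemma free_projP u v : free_proj u = free_proj v <-> free_eq u v.
Proof. by split=> [/eqquotP/asboolP//|H]; apply/eqquotP; exact/asboolP. Qed.

Lemma free_projK (a : free_group) : free_proj (repr a) = a.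
Proof. exact: reprK. Qed.

Lemma free_eq_cat u u' v v' :
  free_eq u u' -> free_eq v v' -> free_eq (u ++ v) (u' ++ v').
Proof.
move=> Hu Hv; apply: (@free_eq_trans _ (u' ++ v)).
  elim: Hu => [w|w w' _|w1 w2 w3 _ H1 _ H2|w1 w2 a e].
  - exact: free_eq_refl.
  - exact: free_eq_sym.
  - exact: free_eq_trans H1 H2.
  - by rewrite -!catA; apply: (free_eq_cancel w1 (w2 ++ v)).
elim: Hv => [w|w w' _|w1 w2 w3 _ H1 _ H2|w1 w2 a e].
- exact: free_eq_refl.
- exact: free_eq_sym.
- exact: free_eq_trans H1 H2.
- by rewrite catA (catA u' w1 w2); apply: free_eq_cancel.
Qed.

Lemma free_eq_inv u v : free_eq u v -> free_eq (inv_word u) (inv_word v).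
Proof.
elim=> [w|w w' _|w1 w2 w3 _ H1 _ H2|w1 w2 a e].
- exact: free_eq_refl.
- exact: free_eq_sym.
- exact: free_eq_trans H1 H2.
- rewrite /inv_word !map_cat !rev_cat -catA /= negbK.
  exact: free_eq_cancel.
Qed.

Lemma inv_wordK : involutive inv_word.
Proof.
move=> u; rewrite /inv_word map_rev revK -map_comp.
by elim: u => //= -[a e] u ->; rewrite /= negbK.
Qed.

Lemma free_eq_mulV u : free_eq (inv_word u ++ u) [::].
Proof.
elim: u => [|[a e] u IH]; first exact: free_eq_refl.
rewrite /inv_word /= rev_cons -cats1 -catA.
apply: free_eq_trans IH.
by have := free_eq_cancel (inv_word u) u a (~~ e); rewrite negbK.
Qed.

Lemma free_projM u v :
  free_proj (u ++ v) = free_mul (free_proj u) (free_proj v).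
Proof.
apply/free_projP; apply: free_eq_cat; apply/free_projP;
  by rewrite free_projK.
Qed.

Lemma free_projV u : free_proj (inv_word u) = free_inv (free_proj u).
Proof.
by apply/free_projP; apply: free_eq_inv; apply/free_projP; rewrite free_projK.
Qed.

Lemma free_mulA : associative free_mul.
Proof.
move=> a b c; rewrite -(free_projK a) -(free_projK b) -(free_projK c).
by rewrite -!free_projM catA.
Qed.

Lemma free_mul1 : left_id free_one free_mul.
Proof. by move=> a; rewrite -(free_projK a) -free_projM. Qed.

Lemma free_mulr1 : right_id free_one free_mul.
Proof. by move=> a; rewrite -(free_projK a) -free_projM cats0. Qed.

Lemma free_mulV : left_inverse free_one free_inv free_mul.
Proof.
move=> a; rewrite -(free_projK a) -free_projV -free_projM.
by apply/free_projP/free_eq_mulV.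
Qed.

Lemma free_mulrV : right_inverse free_one free_inv free_mul.
Proof.
move=> a; rewrite -(free_projK a) -free_projV -free_projM.
apply/free_projP; rewrite -{1}(inv_wordK (repr a)); exact: free_eq_mulV.
Qed.

HB.instance Definition _ := isGroup.Build free_group
  free_mulA free_mul1 free_mulr1 free_mulV free_mulrV.

Definition free_gen (a : A) : free_group := free_proj [:: (a, false)].

End FreeGroup.

(* The group < A | u = v for (u, v) in R >. *)
Section Presentation.
Variables (A : choiceType) (R : set (free_group A * free_group A)).

Definition presented : groupType := quo [set uv.1 / uv.2 | uv in R].

Definition pgen (a : A) : presented := quo_proj _ (free_gen a).

End Presentation.

(* Exponents in N u {oo}: [None] is oo. *)
Definition exponent := option nat.

Definition exponent_ge (j : nat) (k : exponent) : bool :=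
  if k is Some k then j <= k else true.

Definition exponent_mul (k : exponent) (j : nat) : exponent :=
  omap (muln^~ j) k.

(* The torsion relator g^k; there is none when k = oo. *)
Definition torsion (G : groupType) (g : G) (k : exponent) : set G :=
  [set t | exists2 j, k = Some j & t = g ^+ j].

(* J-groups. The generator s_(i+1) is [JGen K i]. *)
Section JGroups.
Variables (p : nat) (K : p.-tuple exponent).

Inductive J_relation : free_group 'I_p -> free_group 'I_p -> Prop :=
  | J_rotation (i : 'I_p) :
      J_relation (\prod_(j <- enum 'I_p) free_gen j)
                 (\prod_(j <- rot i (enum 'I_p)) free_gen j)
  | J_torsion (i : 'I_p) (t : free_group 'I_p) :
      torsion (free_gen i) (tnth K i) t -> J_relation t 1.

Definition JGroup : groupType := presented [set uv | J_relation uv.1 uv.2].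

Definition JGen (i : 'I_p) : JGroup := pgen _ i.

Variable K' : p.-tuple nat.

Definition gJ_gens : set JGroup :=
  [set g | exists i, g = JGen i ^+ tnth K' i].

(* The generalized J-group with rows K and K', as a subgroup of [JGroup].     *)
(* It is meant for K'_i dividing K_i, which the definition does not enforce.  *)
Definition gJ : groupType := ncl_group gJ_gens.

Definition gJ_reflections : set gJ :=
  [set t | t <> 1 /\
     exists s h k, gJ_gens s /\ val t = (gexpz s k) ^ h :> JGroup].

End JGroups.

(* J-braid groups. The generator x_(i+1) is [BX i]. *)
Inductive Bgen (n : nat) := BX of 'I_n | BY | BZ.
Arguments BY {n}.
Arguments BZ {n}.

HB.instance Definition _ n := gen_eqMixin (Bgen n).
HB.instance Definition _ n := gen_choiceMixin (Bgen n).

Section JBraidGroups.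
Variables n m : nat.

Local Notation F := (free_group (Bgen n)).
Local Notation q := (m %/ n).
Local Notation r := (m %% n).
Local Notation y := (free_gen BY : F).
Local Notation z := (free_gen BZ : F).

(* x_i x_(i+1) ... x_j, which is 1 when i > j *)
Definition xprod (i j : nat) : F :=
  \prod_(k < n | i <= k.+1 <= j) free_gen (BX k).

Definition Bdelta : F := xprod 1 n * y.

Inductive B_relation : F -> F -> Prop :=
  | B_rel_comm : B_relation (xprod 1 n * y * z) (z * xprod 1 n * y)
  | B_rel_low (i : nat) : 1 <= i <= n - r ->
      B_relation
        (xprod i.+1 n * y * z * gexpz Bdelta (q%:Z - 1)%R * xprod 1 (i + r))
        (xprod i n * y * z * gexpz Bdelta (q%:Z - 1)%R * xprod 1 (i + r - 1))
  | B_rel_high (i : nat) : n - r + 1 <= i <= n ->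
      B_relation
        (xprod i.+1 n * y * z * Bdelta ^+ q * xprod 1 (i + r - n))
        (xprod i n * y * z * Bdelta ^+ q * xprod 1 (i + r - n - 1)).

(* B^*_*(n,m), B^*(n,m), B_*(n,m) and B(n,m) *)
Definition Bss : groupType := presented [set uv | B_relation uv.1 uv.2].
Definition Bss_gen (a : Bgen n) : Bss := pgen _ a.

Definition Bup : groupType := quo [set Bss_gen BY].
Definition Bup_gen (a : Bgen n) : Bup := quo_proj _ (Bss_gen a).

Definition Blo : groupType := quo [set Bss_gen BZ].
Definition Blo_gen (a : Bgen n) : Blo := quo_proj _ (Bss_gen a).

Definition Bnn : groupType := quo [set Bss_gen BY; Bss_gen BZ].
Definition Bnn_gen (a : Bgen n) : Bnn := quo_proj _ (Bss_gen a).

Variables (K : (gcdn n m).-tuple exponent) (b c : exponent).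

(* x_1^(k_1), ..., x_d^(k_d), where [g a] is the image in G of the generator  *)
(* a. As d <= n, every [j : 'I_d] is the value of some [i : 'I_n].            *)
Definition x_torsion (G : groupType) (g : Bgen n -> G) : set G :=
  [set t | exists (i : 'I_n) (j : 'I_(gcdn n m)),
     i = j :> nat /\ torsion (g (BX i)) (tnth K j) t].

Definition Bss_tors : groupType :=
  quo (x_torsion Bss_gen `|` torsion (Bss_gen BY) b `|` torsion (Bss_gen BZ) c).
Definition Bup_tors : groupType :=
  quo (x_torsion Bup_gen `|` torsion (Bup_gen BZ) c).
Definition Blo_tors : groupType :=
  quo (x_torsion Blo_gen `|` torsion (Blo_gen BY) b).
Definition Bnn_tors : groupType := quo (x_torsion Bnn_gen).

Definition x_gens : set (Bgen n) := range (@BX n).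

(* The nontrivial powers of conjugates of the elements of X. *)
Definition tors_reflections (G : groupType) (X : set G) : set G :=
  [set t | t <> 1 /\ exists s h k, X s /\ t = gexpz (s ^ h) k].

Definition Bss_reflections : set Bss_tors :=
  tors_reflections [set quo_proj _ (Bss_gen a) | a in setT].
Definition Bup_reflections : set Bup_tors :=
  tors_reflections [set quo_proj _ (Bup_gen a) | a in x_gens `|` [set BZ]].
Definition Blo_reflections : set Blo_tors :=
  tors_reflections [set quo_proj _ (Blo_gen a) | a in x_gens `|` [set BY]].
Definition Bnn_reflections : set Bnn_tors :=
  tors_reflections [set quo_proj _ (Bnn_gen a) | a in x_gens].

End JBraidGroups.

Definition ref_isomorphic (G H : groupType) (RG : set G) (RH : set H) : Prop :=
  exists f : {multiplicative G -> H}, bijective f /\ f @` RG = RH.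

(* Main.v *)
Require Import Defs.
From HB Require Import structures.
From mathcomp Require Import all_boot ssralg ssrint.
From mathcomp Require Import boolp classical_sets zify.

(** Write n = n' d and m = m' d with d the gcd of n and m.  Both sides of each
    isomorphism are governed by one picture, a family of elements X_i carried
    along by commuting elements that shift the index.

    On the braid side, extend x_1, ..., x_n to a sequence X (indexed from 0, so
    that X_0 = x_1) by y X_i y^-1 = X_(i+n), put P j = X_0 ... X_(j-1), and let t
    be defined by z^-1 = P m t.  The defining relations then collapse
    ([braid_relsP]) to: t commutes with y, and t X_i t^-1 = X_(i+m).  The
    relations involving the division of m by n only spell this out without ever
    leaving the range 1..n.

    On the J side, write s_1, ..., s_d, u, v for the generators.  The rotation
    relations say that c = s_1 ... s_d u v is central.  Extend s_1, ..., s_d by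
    u S_i u^-1 = S_(i+d).  Then u^n' shifts by n, and v^m' P m is the inverse of
    t = u^m' c^-m', which shifts by m ([frame_of_JGens]).  So x_i |-> S_(i-1),
    y |-> u^n', z |-> v^m' respects the braid relations.  It respects the torsion
    relations as well, since x_1, ..., x_d go to s_1, ..., s_d and
    (u^n')^k = u^(k n'), and similarly for v.

    Conversely u can be recovered from y, t and c.  In J one has
    y^m' t^-n' = c^(n'm'), and if a n' = b m' + 1 then u = t^-b y^a c^-(b m').
    So adjoin to the braid quotient a central c with c^(n'm') = y^m' t^-n', the
    right-hand side being central already; the braid quotient embeds in this
    enlargement ([adjoin_central_root]).  There the element u given by
    this formula and v = (P d u)^-1 c satisfy, together with X_0, ..., X_(d-1),
    the relations of J ([JGens_of_frame]), so J maps to the enlargement, and the composite is the inclusion: the map to J is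
    injective.

    The formula for u also shows that J is the product of the image with the
    central subgroup generated by c.  Hence conjugating by an element of J is the
    same as conjugating by an element of the image, which gives at once that the
    image is normal, so that it is the required normal closure, and that
    reflections match reflections ([ref_isomorphic_ncl]).

    Killing y (resp. z) is imposing y^1 = 1 (resp. z^1 = 1), so all four
    statements are the same one for different exponents.  Groups are handled
    through their universal property ([presents]), which hides how iterated
    quotients were built. *)

Set Implicit Arguments.
Unset Strict Implicit.
Unset Printing Implicit Defensive.

Local Open Scope classical_set_scope.
Local Open Scope quotient_scope.
Local Open Scope group_scope.

Notation ghom G H := (UMagmaMorphism.type G H).

(** * Universal properties of free groups, quotients and presentations *)

Section FreeEval.
Variables (A : choiceType) (G : groupType) (g : A -> G).

Definition letter (l : A * bool) : G := if l.2 then (g l.1)^-1 else g l.1.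

Definition word_eval (w : seq (A * bool)) : G := \prod_(l <- w) letter l.

Lemma word_eval_free_eq w w' : free_eq w w' -> word_eval w = word_eval w'.
Proof.
elim=> [//|u v _ ->//|u v t _ -> _ ->//|u v a e].
rewrite /word_eval !big_cat !big_cons big_nil /= mulg1.
by case: e; rewrite /letter /= ?mulVg ?mulgV mul1g.
Qed.

Definition free_eval (a : free_group A) : G := word_eval (repr a).

Lemma free_eval_proj w : free_eval (free_proj w) = word_eval w.
Proof. by apply: word_eval_free_eq; apply/free_projP; rewrite free_projK. Qed.

Lemma free_evalM : {morph free_eval : a b / a * b}.
Proof. by move=> a b; rewrite free_eval_proj /word_eval big_cat. Qed.

Lemma free_eval1 : free_eval 1 = 1.
Proof. by rewrite free_eval_proj /word_eval big_nil. Qed.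

HB.instance Definition _ :=
  isUMagmaMorphism.Build (free_group A) G free_eval (free_eval1, free_evalM).

Lemma free_eval_gen a : free_eval (free_gen a) = g a.
Proof. by rewrite free_eval_proj /word_eval big_seq1. Qed.

End FreeEval.

Section QuoLift.
Variables (G H : groupType) (S : set G).

HB.instance Definition _ :=
  Multiplicative_isUMagmaMorphism.Build G (quo S) (quo_proj S) erefl.

Lemma quo_proj_eq1 s : S s -> quo_proj S s = 1.
Proof. by move=> Ss; apply/quo_projP; rewrite divg1 => N [_]; apply. Qed.

Variable f : ghom G H.
Hypothesis f_S : forall s, S s -> f s = 1.

Lemma normal_closure_ker g : normal_closure S g -> f g = 1.
Proof.
move=> Ng; apply: (Ng [set x | f x = 1]); split => //.
split=> /= [|x y fx fy|x fx|x y fx].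
- exact: gmulf1.
- by rewrite gmulfM fx fy mulg1.
- by rewrite gmulfV fx invg1.
- by rewrite gmulfJ fx conj1g.
Qed.

(** The proof that f kills S is an argument so that the morphism structure,
    which depends on it, can be found from the term alone. *)
Definition quo_lift (_ : forall s, S s -> f s = 1) (a : quo S) : H := f (repr a).

Lemma quo_lift_proj g : quo_lift f_S (quo_proj S g) = f g.
Proof.
apply/divg1_eq; rewrite -gmulfF; apply: normal_closure_ker.
by apply/quo_projP; rewrite quo_projK.
Qed.

Lemma quo_liftM : {morph quo_lift f_S : a b / a * b}.
Proof.
move=> a b; rewrite -(quo_projK a) -(quo_projK b) -gmulfM.
by rewrite !quo_lift_proj gmulfM.
Qed.

Lemma quo_lift1 : quo_lift f_S 1 = 1.
Proof. by rewrite quo_lift_proj gmulf1. Qed.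

HB.instance Definition _ :=
  isUMagmaMorphism.Build (quo S) H (quo_lift f_S) (quo_lift1, quo_liftM).

End QuoLift.

(** The induction principle of the subgroup generated by the g a, when this
    subgroup is everything. *)
Definition generates (A : Type) (G : groupType) (g : A -> G) : Prop :=
  forall P : set G, P 1 -> (forall x y, P x -> P y -> P (x * y)) ->
    (forall x, P x -> P x^-1) -> (forall a, P (g a)) -> forall x, P x.

(** A presentation up to isomorphism: R is the condition that the relations put
    on a family of elements of a group, and g is the universal family
    satisfying it. *)
Record presents (A : Type) (R : forall G : groupType, (A -> G) -> Prop)
    (Q : groupType) (g : A -> Q) : Prop := Presents {
  presents_rel : R Q g;
  presents_gen : generates g;
  presents_lift : forall (G : groupType) (h : A -> G), R G h ->
    exists f : ghom Q G, forall a, f (g a) = h a }.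

Lemma generates_eq (A : Type) (G H : groupType) (g : A -> G) (f f' : ghom G H) :
  generates g -> (forall a, f (g a) = f' (g a)) -> f =1 f'.
Proof.
move=> gen eqff'; apply: gen => [|x y Ex Ey|x Ex|//].
- by rewrite !gmulf1.
- by rewrite !gmulfM Ex Ey.
- by rewrite !gmulfV Ex.
Qed.

Lemma free_gen_generates (A : choiceType) : generates (@free_gen A).
Proof.
move=> P P1 PM PV Pg x; rewrite -(free_projK x); elim: (repr x) => [//|[a e] w IHw].
rewrite -cat1s free_projM; apply: PM => //.
by case: e; [rewrite (free_projV [:: (a, false)]); apply: PV|]; apply: Pg.
Qed.

Lemma quo_generates (A : Type) (G : groupType) (g : A -> G) (S : set G) :
  generates g -> generates (fun a => quo_proj S (g a)).
Proof.
move=> gen P P1 PM PV Pg x; rewrite -(quo_projK x); move: (repr x).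
apply: gen => // [y z|y].
- by rewrite gmulfM; apply: PM.
- by rewrite gmulfV; apply: PV.
Qed.

Definition holds (A : choiceType) (R : set (free_group A * free_group A))
    (G : groupType) (g : A -> G) : Prop :=
  forall uv, R uv -> free_eval g uv.1 = free_eval g uv.2.

Lemma presented_presents (A : choiceType) (R : set (free_group A * free_group A)) :
  presents (holds R) (pgen R).
Proof.
pose S := [set uv.1 / uv.2 | uv in R].
have genR : generates (pgen R) := quo_generates (S := S) (@free_gen_generates A).
split=> // [uv Ruv|G h hR].
  have E := generates_eq (f := free_eval (pgen R)) (f' := quo_proj S)
    (@free_gen_generates A) (free_eval_gen (pgen R)).
  rewrite !E; apply/divg1_eq; rewrite -gmulfF; apply: quo_proj_eq1.
  by exists uv.
have hS s : S s -> free_eval h s = 1.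
  by move=> [uv /hR Euv <-]; rewrite gmulfF /= Euv mulgV.
exists (quo_lift hS) => a.
by rewrite -(free_eval_gen h a); apply: (quo_lift_proj hS).
Qed.

(** How a presentation changes in a quotient.  The new relations R' only have to
    be understood on families that already come from Q, where they must amount
    to killing S. *)
Lemma quo_presents (A : Type) (R R' : forall G : groupType, (A -> G) -> Prop)
    (Q : groupType) (g : A -> Q) (S : set Q) :
    presents R g ->
    (forall (G : groupType) (f : ghom Q G),
       R' G (fun a => f (g a)) <-> forall s, S s -> f s = 1) ->
    (forall G h, R' G h -> R G h) ->
  presents R' (fun a => quo_proj S (g a)).
Proof.
move=> [Rg gen lift] R'E R'R; split=> [||G h R'h].
- by apply/R'E => s /quo_proj_eq1.
- exact: quo_generates.
have [f fE] := lift _ _ (R'R _ _ R'h).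
have fS s : S s -> f s = 1.
  by move: s; apply/R'E; congr (R' _ _): R'h; apply/funext=> a; rewrite fE.
by exists (quo_lift fS) => a; rewrite -fE; apply: (quo_lift_proj fS).
Qed.

Lemma presents_iff (A : Type) (R R' : forall G : groupType, (A -> G) -> Prop)
    (Q : groupType) (g : A -> Q) :
  (forall G h, R G h <-> R' G h) -> presents R g -> presents R' g.
Proof.
move=> RR' [Rg gen lift]; split=> //; first exact/RR'.
by move=> G h /RR'; apply: lift.
Qed.
(** * Sequences shifted by a group element *)

Section Shifts.
Variable G : groupType.
Implicit Types (X : nat -> G) (y z : G).

Definition shifts (a : nat) (y : G) X : Prop :=
  forall i, y * X i = X (i + a) * y.

Lemma shiftsM a b y z X : shifts a y X -> shifts b z X -> shifts (b + a) (y * z) X.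
Proof. by move=> Hy Hz i; rewrite -mulgA Hz mulgA Hy -mulgA addnA. Qed.

Lemma shifts0 X : shifts 0 1 X.
Proof. by move=> i; rewrite mul1g mulg1 addn0. Qed.

Lemma shiftsX a y X k : shifts a y X -> shifts (k * a) (y ^+ k) X.
Proof.
move=> Hy; elim: k => [|k IHk]; first exact: shifts0.
by rewrite expgSr mulSn; apply: shiftsM.
Qed.

(** Composing with y^-1 on the left never needs an index below 0, which is why
    differences of shifts are taken in this order. *)
Lemma shiftsVM a b y z X : shifts a y X -> shifts (b + a) z X -> shifts b (y^-1 * z) X.
Proof.
move=> Hy Hz i; apply: (mulgI y).
by rewrite mulgA mulVKg Hz addnA mulgA Hy -mulgA mulVKg.
Qed.

Definition pprod X (j : nat) : G := \prod_(0 <= i < j) X i.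

Lemma pprod0 X : pprod X 0 = 1.
Proof. by rewrite /pprod big_geq. Qed.

Lemma pprodS X j : pprod X j.+1 = pprod X j * X j.
Proof. by rewrite /pprod big_nat_recr. Qed.

(** Moving y through the last i factors turns them into X_a, ..., X_(a+i-1). *)
Lemma pprod_shift a y X i : shifts a y X ->
  pprod X (a + i) = pprod X a * y * pprod X i * y^-1.
Proof.
move=> Hy; elim: i => [|i IHi]; first by rewrite addn0 pprod0 mulg1 mulgK.
rewrite addnS !pprodS IHi -!mulgA; do 3!congr (_ * _).
by apply: (mulgI y); rewrite mulVKg addnC mulgA Hy mulgK.
Qed.

Lemma pprod_shiftX a y X k i : shifts a y X ->
  pprod X (k * a + i) = (pprod X a * y) ^+ k * pprod X i * y ^- k.
Proof.
move=> Hy; elim: k => [|k IHk]; first by rewrite !expg0 mul1g invg1 mulg1.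
by rewrite mulSn -addnA (pprod_shift _ Hy) IHk !expgS invgM !mulgA.
Qed.

Lemma shifts_eq n y X X' : 0 < n -> shifts n y X -> shifts n y X' ->
  (forall i, i < n -> X i = X' i) -> X =1 X'.
Proof.
move=> n_gt0 HX HX' E i; rewrite (divn_eq i n) addnC.
apply: (mulIg (y ^+ (i %/ n))).
by rewrite -(shiftsX _ HX) -(shiftsX _ HX') E // ltn_pmod.
Qed.

Lemma shifts_extend n m y t X : 0 < n -> shifts n y X -> commute t y ->
  (forall i, i < n -> t * X i = X (i + m) * t) -> shifts m t X.
Proof.
move=> n_gt0 Hy cty Ht i; set k := i %/ n.
have cyk : commute t (y ^+ k) by apply: commuteX.
have E j : X (j + k * n) = y ^+ k * X j * y ^- k.
  by rewrite (shiftsX _ Hy) mulgK.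
rewrite (divn_eq i n) -/k addnC addnAC !E -[RHS]mulgA -(commuteV cyk).
by rewrite !mulgA cyk -(mulgA (y ^+ k) t) Ht ?ltn_pmod // !mulgA.
Qed.

End Shifts.

(** The extension of x_0, ..., x_(n-1) to all indices that is shifted by n under
    conjugation by y.  It is locked because unification would otherwise unfold
    it, as a conjugate, into a product. *)
HB.lock Definition twist (n : nat) (n_gt0 : 0 < n) (G : groupType)
    (x : 'I_n -> G) (y : G) (i : nat) : G :=
  x (Ordinal (ltn_pmod i n_gt0)) ^ (y ^- (i %/ n)).
Canonical twist_unlockable := Unlockable twist.unlock.

Section Twist.
Variables (n : nat) (n_gt0 : 0 < n).

Lemma twist_ord (G : groupType) (x : 'I_n -> G) y (i : 'I_n) : twist n_gt0 x y i = x i.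
Proof.
rewrite !unlock divn_small // expg0 invg1 conjg1; congr x.
by apply: val_inj; rewrite /= modn_small.
Qed.

Lemma twist_shifts (G : groupType) (x : 'I_n -> G) y : shifts n y (twist n_gt0 x y).
Proof.
move=> i; rewrite !unlock divnDr // divnn n_gt0 addn1 expgS invgM conjgM.
rewrite [X in X * y]conjgE invgK -[RHS]mulgA mulgVK; congr (_ * x _ ^ _).
by apply: val_inj; rewrite /= modnDr.
Qed.

Lemma twist_uniq (G : groupType) (x : 'I_n -> G) y X :
  shifts n y X -> (forall i : 'I_n, X i = x i) -> X =1 twist n_gt0 x y.
Proof.
move=> HX E; apply: (shifts_eq n_gt0 HX); first exact: twist_shifts.
by move=> i lti; rewrite -[i]/(nat_of_ord (Ordinal lti)) E twist_ord.
Qed.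

Lemma twist_morph (G H : groupType) (f : ghom G H) (x : 'I_n -> G) y i :
  f (twist n_gt0 x y i) = twist n_gt0 (fun k => f (x k)) (f y) i.
Proof. by rewrite !unlock gmulfJ gmulfV gmulfXn. Qed.

End Twist.

Lemma pprod_morph (G H : groupType) (f : ghom G H) X j :
  f (pprod X j) = pprod (fun i => f (X i)) j.
Proof. by rewrite /pprod gmulf_prod. Qed.

Lemma eq_pprod (G : groupType) (X X' : nat -> G) j : X =1 X' -> pprod X j = pprod X' j.
Proof. by move=> E; apply: eq_bigr => i _; apply: E. Qed.

(** * The braid relations as two commutations with shifts *)

Lemma gexpz_morph (G H : groupType) (f : ghom G H) a k :
  f (gexpz a k) = gexpz (f a) k.
Proof. by case: k => k /=; rewrite ?gmulfV gmulfXn. Qed.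

Lemma gexpz_pred (G : groupType) (a : G) q : gexpz a (q%:Z - 1)%R = a ^+ q * a^-1.
Proof.
case: q => [|q]; first by rewrite mul1g.
by rewrite expgSr mulgK (_ : (q.+1%:Z - 1)%R = Posz q) // -addn1 PoszD GRing.addrK.
Qed.

Section BraidRelations.
Variables (n m : nat) (n_gt0 : 0 < n) (G : groupType) (g : Bgen n -> G).

Local Notation x := (fun i => g (BX i)).
Local Notation y := (g BY).
Local Notation z := (g BZ).
Local Notation X := (twist n_gt0 x y).
Local Notation P := (pprod X).
Local Notation q := (m %/ n).
Local Notation r := (m %% n).
Local Notation delta := (P n * y).
Local Notation B_rel := [set uv | @B_relation n m uv.1 uv.2].

Variable t : G.
Hypothesis tE : z * P m = t^-1.

Lemma eval_xprod i j : i <= j <= n -> free_eval g (xprod n i.+1 j) = (P i)^-1 * P j.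
Proof.
case/andP=> leij lejn; rewrite /xprod gmulf_prod /=.
under eq_bigr do rewrite free_eval_gen -(twist_ord n_gt0 x y).
rewrite -(big_mkord (fun k => i < k.+1 <= j) X).
have Eij : P j = P i * \prod_(i <= k < j) X k.
  by rewrite /pprod (big_cat_nat (n := i)).
rewrite Eij mulKg (big_cat_nat (n := i)) ?(leq_trans leij) //.
rewrite (big_cat_nat (m := i) (n := j)) // big_nat_cond big1; last first.
  by move=> k /andP[/andP[_ ki] /andP[ik _]]; have := leq_trans ik ki; rewrite ltnn.
rewrite /= mul1g [X in _ * X]big_nat_cond [X in _ * X]big1; last first.
  by move=> k /andP[/andP[jk _] /andP[_ kj]]; have := leq_trans kj jk; rewrite ltnn.
rewrite mulg1 big_nat_cond [RHS]big_nat_cond; apply: eq_bigl => k.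
by rewrite ltnS andbb andbT.
Qed.

Lemma eval_Bdelta : free_eval g (Bdelta n) = delta.
Proof.
by rewrite gmulfM /= eval_xprod ?leqnn // pprod0 invg1 mul1g free_eval_gen.
Qed.

Let y_X : shifts n y X. Proof. exact: twist_shifts. Qed.

(* With j + r in place of j + m the indices stay in the range of the given
   relators; the quotient q is absorbed by powers of delta and y. *)
Let P_mod j : P (j + m) * y ^+ q = delta ^+ q * P (j + r).
Proof.
by rewrite {1}(divn_eq m n) addnCA (pprod_shiftX _ _ y_X) mulgVK.
Qed.

Section Relators.
Hypothesis dz : commute delta z.

Let eval_prefix i : i <= n ->
  free_eval g (xprod n i.+1 n * free_gen BY * free_gen BZ) = (P i)^-1 * z * delta.
Proof.
move=> lein; rewrite !gmulfM /= eval_xprod ?lein ?leqnn // !free_eval_gen.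
by rewrite -[_ * P n * y]mulgA -mulgA dz mulgA.
Qed.

(** Once delta commutes with z, both families of relators equate consecutive
    values of (P i)^-1 z P (i + m), up to a common power of y: this lemma and the
    next one evaluate their sides in these terms. *)
Lemma eval_low i j : i <= n -> j + r <= n ->
  free_eval g (xprod n i.+1 n * free_gen BY * free_gen BZ
     * gexpz (Bdelta n) (q%:Z - 1)%R * xprod n 1 (j + r)) =
  (P i)^-1 * z * P (j + m) * y ^+ q.
Proof.
move=> lein lejr; rewrite 2!gmulfM gexpz_morph /= gexpz_pred eval_prefix //.
rewrite eval_Bdelta eval_xprod // pprod0 invg1 mul1g -[RHS]mulgA P_mod.
rewrite -2![LHS]mulgA; congr (_ * _); rewrite [LHS]mulgA; congr (_ * _).
by rewrite mulgA -expgS expgSr mulgK.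
Qed.

Lemma eval_high i j : i <= n -> n <= j + r -> j <= n ->
  free_eval g (xprod n i.+1 n * free_gen BY * free_gen BZ
     * Bdelta n ^+ q * xprod n 1 (j + r - n)) =
  (P i)^-1 * z * P (j + m) * y ^+ q.+1.
Proof.
move=> lein lenj lejn; rewrite 2!gmulfM gmulfXn /= eval_prefix //.
rewrite eval_Bdelta eval_xprod; last first.
  by rewrite leq0n leq_subLR leq_add // ltnW // ltn_pmod.
rewrite pprod0 invg1 mul1g -[RHS]mulgA -[LHS]mulgA -[LHS]mulgA; congr (_ * _).
have -> : j + m = q.+1 * n + (j + r - n).
  by rewrite {1}(divn_eq m n) mulSn addnAC subnKC // -addnA (addnC r).
by rewrite (pprod_shiftX _ _ y_X) mulgVK mulgA -expgS.
Qed.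

End Relators.

Let P_step : shifts m t X -> forall i, z * P (i + m) = P i * t^-1.
Proof.
by move=> t_X i; rewrite addnC (pprod_shift _ t_X) !mulgA tE mulVg mul1g.
Qed.

(** The relations say that (P i)^-1 z P (i + m) does not depend on i for
    0 <= i <= n.  At i = 0 the value is t^-1; comparing i with i + 1 gives
    X_i t^-1 = t^-1 X_(i+m), and comparing i = 0 with i = n, where P (n + m) can
    be computed by shifting by y, gives that t commutes with y. *)
Lemma braid_relsP : holds B_rel g <-> commute t y /\ shifts m t X.
Proof.
have ltrn : r < n by rewrite ltn_pmod.
split=> [rels|[cty t_X]].
  have dz : commute delta z.
    have /= := rels (_, _) (B_rel_comm n m).
    rewrite !gmulfM /= eval_xprod ?leqnn // !free_eval_gen pprod0 invg1 mul1g => E.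
    by rewrite /commute mulgA.
  have step i : i <= n -> z * P (i + m) = P i * t^-1.
    elim: i => [|i IHi] lt_in; first by rewrite pprod0 mul1g tE.
    suff : (P i.+1)^-1 * z * P (i.+1 + m) = (P i)^-1 * z * P (i + m).
      rewrite -2!mulgA IHi ?(ltnW lt_in) // mulKg => <-.
      by rewrite mulVKg.
    have [le_low|lt_high] := leqP (i.+1) (n - r).
      have /= := rels (_, _) (@B_rel_low n m i.+1 le_low).
      rewrite addSn subn1 -[(i + r).+1]addSn /=.
      by rewrite !eval_low //; [apply: mulIg | lia..].
    have i_high : n - r + 1 <= i.+1 <= n by lia.
    have /= := rels (_, _) (@B_rel_high n m i.+1 i_high).
    rewrite subnAC addSn subn1 -[(i + r).+1]addSn /=.
    by rewrite !eval_high //; [apply: mulIg | lia..].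
  have cty : commute t y.
    have := step n (leqnn n).
    rewrite (pprod_shift _ y_X) 2!mulgA -dz -(mulgA delta) tE -2!mulgA => /mulgI E.
    have /commuteV : commute y t^-1 by rewrite /commute -[in RHS]E mulgA mulgVK.
    by rewrite invgK => /commute_sym.
  split=> //; apply: (shifts_extend n_gt0 y_X cty) => i lt_in.
  have := step _ lt_in; rewrite addSn !pprodS mulgA step ?(ltnW lt_in) // -!mulgA.
  by move=> /mulgI E; apply: (mulgI t^-1); rewrite mulKg mulgA E mulgVK.
have cVy : commute y t^-1 by apply/commuteV/commute_sym.
have dz : commute delta z.
  apply: (mulIg (P m)); rewrite -mulgA tE -mulgA cVy mulgA -P_step //.
  by rewrite (pprod_shift _ y_X) -mulgA mulgVK mulgA.
have low i : (P i)^-1 * z * P (i + m) = t^-1 by rewrite -mulgA P_step // mulKg.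
move=> [u v] /= uv; case: uv dz => {u v} [|[//|i] i_low|[//|i] i_high] dz.
- rewrite !gmulfM /= eval_xprod ?leqnn // !free_eval_gen pprod0 invg1 mul1g.
  by rewrite dz mulgA.
- rewrite addSn subn1 -[(i + r).+1]addSn /=.
  by rewrite !eval_low // ?low //; lia.
- by move: i_high; rewrite addn1.
- rewrite subnAC addSn subn1 -[(i + r).+1]addSn /=.
  by rewrite !eval_high // ?low //; lia.
Qed.

End BraidRelations.

(** * The J-group: a central product of the generators *)

Definition killed (G : groupType) (x : G) (k : exponent) : Prop :=
  forall j, k = Some j -> x ^+ j = 1.

Lemma killed1 (G : groupType) (x : G) : killed x (Some 1%N) <-> x = 1.
Proof. by split=> [/(_ _ erefl)|-> j _]; [rewrite expg1|rewrite expg1n]. Qed.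

Lemma killedX (G : groupType) (x : G) k j :
  killed x (exponent_mul k j) <-> killed (x ^+ j) k.
Proof.
case: k => [k|]; split=> // kx i [<-]; first by rewrite -expgnA mulnC kx.
by rewrite mulnC expgnA kx.
Qed.

Lemma killed_morph (G H : groupType) (f : ghom G H) x k : killed x k -> killed (f x) k.
Proof. by move=> kx j /kx xj; rewrite -gmulfXn xj gmulf1. Qed.

Section JPresentation.
Variables (p : nat) (K : p.-tuple exponent).

Definition J_rel (G : groupType) (g : 'I_p -> G) : Prop :=
  (forall i, commute (\prod_(j <- enum 'I_p) g j) (g i)) /\
  forall i, killed (g i) (tnth K i).

(** A rotation of the product C of all generators is its conjugate by a prefix,
    so the rotation relations say that C commutes with all prefixes,
    equivalently with all generators. *)
Lemma J_relP (G : groupType) (g : 'I_p -> G) :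
  holds [set uv | J_relation K uv.1 uv.2] g <-> J_rel g.
Proof.
pose T k := \prod_(j <- take k (enum 'I_p)) g j.
set C := \prod_(j <- enum 'I_p) g j.
have rotE k : \prod_(j <- rot k (enum 'I_p)) g j = C ^ T k.
  rewrite /C -{2}(cat_take_drop k (enum 'I_p)) /rot !big_cat /= -/(T k).
  by rewrite conjgE -!mulgA mulKg.
have TS (i : 'I_p) : T i.+1 = T i * g i.
  rewrite /T (take_nth i) ?size_enum_ord // nth_ord_enum.
  by rewrite -cats1 big_cat /= big_seq1.
have evalT s : free_eval g (\prod_(j <- s) free_gen j) = \prod_(j <- s) g j.
  by rewrite gmulf_prod; apply: eq_bigr => j _; apply: free_eval_gen.
split=> [rels|[comm tors] [_ _] /= [i|i _ [j Kj ->]]]; last 2 first.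
- rewrite !evalT rotE -/C conjgE; apply: (mulgI (T i)); rewrite mulVKg.
  by apply: commute_sym; apply: commute_prod => j _; apply: comm.
- by rewrite gmulfXn gmulf1 /= free_eval_gen tors.
split=> [i|i]; last first.
  move=> j Kj; have /= := rels (_, _) (J_torsion (ex_intro2 _ _ j Kj erefl)).
  by rewrite gmulfXn gmulf1 /= free_eval_gen.
have commT k : k <= p -> commute C (T k).
  rewrite leq_eqVlt => /orP[/eqP->|ltk].
    by rewrite /T take_oversize ?size_enum_ord //; apply: commute_refl.
  have /= := rels (_, _) (J_rotation K (Ordinal ltk)).
  by rewrite !evalT rotE -/C conjgE => E; rewrite /commute {2}E mulVKg.
have -> : g i = (T i)^-1 * T i.+1 by rewrite TS mulKg.
by apply: commuteM; [apply: commuteV|]; apply: commT => //; apply: ltnW.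
Qed.

Lemma J_presents : presents J_rel (@JGen p K).
Proof.
apply: presents_iff (presented_presents [set uv | J_relation K uv.1 uv.2]).
exact: J_relP.
Qed.

End JPresentation.

(** * Adjoining a root of a central element *)

Section CentralRoot.
Variables (G : groupType) (zeta : G) (L : nat) (L_gt0 : 0 < L).
Hypothesis zetaC : forall x, commute zeta x.

(** The pair (g, i) stands for g c^i, where c is the new root: sums of exponents
    are reduced modulo L, the carry contributing powers of zeta. *)
Definition central_root of (forall x, commute zeta x) & 0 < L : Type := (G * 'I_L)%type.
Local Notation E := (central_root zetaC L_gt0).
HB.instance Definition _ := Choice.on E.

Local Notation "k %:L" := (Ordinal (ltn_pmod k L_gt0)) (at level 1, format "k %:L").

(** The element g c^k for an unreduced exponent k. *)
Definition root_of (g : G) (k : nat) : E := (g * zeta ^+ (k %/ L), k%:L).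

Definition root_mul (a b : E) : E := root_of (a.1 * b.1) (a.2 + b.2).
Definition root_one : E := root_of 1 0.
(** The carry is written as it appears in the product with a, which covers the
    case of a zero exponent too. *)
Definition root_inv (a : E) : E :=
  let k := (L - a.2) %% L in ((a.1 * zeta ^+ ((k + a.2) %/ L))^-1, (L - a.2)%:L).

Lemma root_ofM g h i j : root_mul (root_of g i) (root_of h j) = root_of (g * h) (i + j).
Proof.
have zC k x : x * zeta ^+ k = zeta ^+ k * x.
  by rewrite -commuteX //; apply/commute_sym/zetaC.
have E : i + j = (i %/ L + j %/ L) * L + (i %% L + j %% L).
  by have := divn_eq i L; have := divn_eq j L; lia.
congr pair; last by apply: val_inj; rewrite /= modnDm.
rewrite /= [in RHS]E divnMDl // !expgnDr !mulgA; congr (_ * _).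
by rewrite -(mulgA g) -zC !mulgA.
Qed.

Lemma root_ofE (a : E) : a = root_of a.1 a.2.
Proof.
case: a => g i; rewrite /root_of /= divn_small // mulg1; congr pair.
by apply: val_inj; rewrite /= modn_small.
Qed.

Lemma root_mulA : associative root_mul.
Proof.
move=> a b c; rewrite (root_ofE a) (root_ofE b) (root_ofE c) !root_ofM.
by rewrite mulgA addnA.
Qed.

Lemma root_mul1 : left_id root_one root_mul.
Proof. by move=> a; rewrite (root_ofE a) root_ofM mul1g. Qed.

Lemma root_mulr1 : right_id root_one root_mul.
Proof. by move=> a; rewrite (root_ofE a) root_ofM mulg1 addn0. Qed.

Let root_inv_mod (a : E) : ((L - a.2) %% L + a.2) %% L = 0.
Proof. by rewrite modnDml subnK ?modnn // ltnW. Qed.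

Lemma root_mulV : left_inverse root_one root_inv root_mul.
Proof.
move=> a; rewrite /root_mul /root_of /=; congr pair; last first.
  by apply: val_inj; rewrite /= root_inv_mod mod0n.
by rewrite div0n mulg1 invgM mulgVK mulVg.
Qed.

Lemma root_mulrV : right_inverse root_one root_inv root_mul.
Proof.
move=> a; rewrite /root_mul /root_of /=; congr pair; last first.
  by apply: val_inj; rewrite /= addnC root_inv_mod mod0n.
rewrite div0n mulg1 addnC; set k := (_ %/ L).
have <- : zeta ^+ k * a.1 = a.1 * zeta ^+ k by apply/commute_sym/commuteX/commute_sym.
by rewrite invgM mulgA mulgV mul1g mulVg.
Qed.

HB.instance Definition _ :=
  isGroup.Build E root_mulA root_mul1 root_mulr1 root_mulV root_mulrV.

Definition root_incl (g : G) : E := root_of g 0.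

Lemma root_inclM : {morph root_incl : g h / g * h}.
Proof. by move=> g h; rewrite [RHS]root_ofM. Qed.

HB.instance Definition _ :=
  isUMagmaMorphism.Build G E root_incl (erefl, root_inclM).

Lemma root_incl_inj : injective root_incl.
Proof. by move=> g h [] /mulIg. Qed.

Definition root : E := root_of 1 1.

Lemma root_central (a : E) : commute root a.
Proof. by rewrite (root_ofE a) /commute [LHS]root_ofM [RHS]root_ofM mul1g mulg1 addnC. Qed.

Lemma root_exp : root ^+ L = root_incl zeta.
Proof.
have rootX k : root ^+ k = root_of 1 k.
  by elim: k => // k IHk; rewrite expgSr IHk [LHS]root_ofM mulg1 addn1.
rewrite rootX; congr pair; last by apply: val_inj; rewrite /= modnn mod0n.
by rewrite divnn L_gt0 div0n mul1g mulg1.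
Qed.

End CentralRoot.

Lemma adjoin_central_root (G : groupType) (zeta : G) (L : nat) :
    0 < L -> (forall x, commute zeta x) ->
  exists (E : groupType) (incl : ghom G E) (c : E),
    [/\ injective incl, forall a, commute c a & c ^+ L = incl zeta].
Proof.
move=> L_gt0 zetaC; exists (central_root zetaC L_gt0).
exists (root_incl L_gt0 zetaC), (root L_gt0 zetaC).
split; [exact: root_incl_inj|exact: root_central|exact: root_exp].
Qed.

(** * Passing between shifts by d and shifts by n and m *)

Section Frames.
Variables (G : groupType) (d n' m' : nat) (X : nat -> G).

(** Since P d u = c v^-1 with c central, P (m' d) = (P d u)^m' u^-m' equals
    c^m' v^-m' u^-m'. *)
Lemma frame_of_JGens (u v : G) (c := pprod X d * u * v) (t := u ^+ m' * c ^- m') :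
    shifts d u X -> commute c v -> commute c u -> (forall i, commute c (X i)) ->
  [/\ v ^+ m' * pprod X (m' * d) = t^-1, commute t (u ^+ n')
    & shifts (m' * d) t X].
Proof.
move=> u_X cv cu cX.
have wE : pprod X d * u = c * v^-1 by rewrite mulgK.
have cXm i : commute (c ^+ m') (X i) by apply/commute_sym/commuteX/commute_sym.
split.
- rewrite -[(m' * d)%N]addn0 (pprod_shiftX _ _ u_X) pprod0 mulg1 wE expgnFl //.
  rewrite mulgA /t invgM invgK; congr (_ * _).
  by rewrite mulgA -(commuteX2 _ _ cv) mulgK.
- apply/commute_sym/commuteM; first by apply/commuteX2/commute_refl.
  by apply/commuteV/commuteX2/commute_sym.
- move=> i; rewrite /t -mulgA -(commuteV (commute_sym (cXm i))).
  by rewrite !mulgA (shiftsX _ u_X).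
Qed.

(** The Bezout relation makes u shift by a n' d - b m' d = d.  The powers of c in u
    compensate for those of y and t through c^(n' m') = y^m' t^-n': formally
    u^n' = y^(1 + b m') t^(- b n') c^(- b m' n') = y, and similarly for u^m'. *)
Lemma JGens_of_frame (y t z c : G) (a b : nat)
    (u := t ^- b * y ^+ a * c ^- (b * m')) (v := (pprod X d * u)^-1 * c) :
    (a * n' = (b * m').+1)%N -> shifts (n' * d) y X -> shifts (m' * d) t X ->
    z * pprod X (m' * d) = t^-1 ->
    commute t y -> commute c t -> commute c y -> (forall i, commute c (X i)) ->
    c ^+ (n' * m') = y ^+ m' * t ^- n' ->
  [/\ shifts d u X, u ^+ n' = y, u ^+ m' = t * c ^+ m' & v ^+ m' = z].
Proof.
move=> bez y_X t_X tE cty cct ccy ccX cE.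
have u_X : shifts d u X.
  have w_X : shifts d (t ^- b * y ^+ a) X.
    apply: shiftsVM (shiftsX b t_X) _.
    by have := shiftsX a y_X; rewrite mulnA bez mulSn mulnA.
  move=> i; rewrite /u -mulgA.
  have -> : c ^- (b * m') * X i = X i * c ^- (b * m').
    by apply/commute_sym/commuteV/commuteX/commute_sym.
  by rewrite mulgA w_X !mulgA.
have uX k : u ^+ k = t ^- (b * k) * y ^+ (a * k) * c ^- (b * m' * k).
  rewrite /u expgnFl; last first.
    apply/commute_sym/commuteM; last by apply/commuteX2/commute_sym.
    by apply/commuteV/commuteX2.
  by rewrite expgMn ?expVgn -?expgnA //; apply/commute_sym/commuteV/commuteX2/commute_sym.
have cX k : c ^+ (n' * m' * k) = y ^+ (m' * k) * t ^- (n' * k).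
  rewrite expgnA cE expgMn ?expVgn -?expgnA //.
  exact/commuteV/commuteX2/commute_sym.
have ctyV k l : t ^- k * y ^+ l = y ^+ l * t ^- k.
  exact/commute_sym/commuteV/commuteX2/commute_sym.
have un : u ^+ n' = y.
  apply: (mulIg (c ^+ (b * m' * n'))); rewrite uX mulgVK bez.
  have -> : (b * m' * n' = n' * m' * b)%N by rewrite -mulnA mulnC (mulnC m').
  by rewrite cX ctyV expgS (mulnC m') (mulnC n') mulgA.
have um : u ^+ m' = t * c ^+ m'.
  apply: (mulIg (c ^+ (b * m' * m'))); rewrite uX mulgVK -mulgA -expgnDr -mulSn.
  have -> : ((b * m').+1 * m' = n' * m' * a)%N by rewrite -bez -mulnA mulnC.
  by rewrite cX (mulnC n') bez -ctyV expgSr invgM (mulnC m') -!mulgA mulVKg.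
split=> //.
have cu : commute c (pprod X d * u).
  apply: commuteM; first by apply: commute_prod.
  apply: commuteM; last by apply/commuteV/commuteX/commute_refl.
  by apply: commuteM; [apply/commuteV|]; apply: commuteX.
rewrite /v expgMn; last by apply/commute_sym/commuteV.
rewrite expVgn.
have -> : (pprod X d * u) ^+ m' = pprod X (m' * d) * u ^+ m'.
  by rewrite -[(m' * d)%N]addn0 (pprod_shiftX _ _ u_X) pprod0 mulg1 mulgVK.
apply: (mulIg (pprod X (m' * d))); rewrite tE um.
have cP : commute (c ^+ m') (pprod X (m' * d)).
  by apply/commute_sym/commuteX/commute_sym/commute_prod.
have ctm : commute (c ^+ m') t^-1 by apply/commuteV/commute_sym/commuteX/commute_sym.
by rewrite -mulgA cP invgM mulgA mulgVK invgM -mulgA -ctm mulKg.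
Qed.

End Frames.

(** * Reflections in an image that differs from the whole group by its centre *)

Lemma gexpzJ (G : groupType) (x h : G) k : gexpz (x ^ h) k = gexpz x k ^ h.
Proof. by case: k => k /=; rewrite ?conjVg conjXg. Qed.

Section Corestriction.
Variables (Q J : groupType) (f : ghom Q J) (S : set J).
Hypothesis f_S : forall a, normal_closure S (f a).

Definition ncl_lift (a : Q) : ncl_group S :=
  Sub (f a) (mem_set (f_S a)).

Lemma val_ncl_lift a : val (ncl_lift a) = f a.
Proof. by rewrite SubK. Qed.

Lemma ncl_liftM : {morph ncl_lift : a b / a * b}.
Proof. by move=> a b; apply: val_inj; rewrite valM !val_ncl_lift gmulfM. Qed.

HB.instance Definition _ :=
  isMultiplicative.Build Q (ncl_group S) ncl_lift ncl_liftM.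

End Corestriction.

(** Every h in J is f q times a central element, so that conjugating by h is
    conjugating by f q.  This makes the image of f normal, hence equal to the
    normal closure of S, and turns a conjugate in J of a power of an element of S
    into the image of a conjugate in Q. *)
Lemma ref_isomorphic_ncl (A : Type) (Q J : groupType) (g : A -> Q) (f : ghom Q J)
    (S : set J) :
    injective f ->
    (forall h, exists q w, h = f q * w /\ forall x, commute w x) ->
    generates g ->
    (forall a, exists s h, S s /\ f (g a) = s ^ h) ->
    (forall s, S s -> exists a, s = f (g a)) ->
  ref_isomorphic (tors_reflections [set g a | a in setT])
    [set t : ncl_group S | t <> 1 /\
       exists s h k, S s /\ val t = (gexpz s k) ^ h :> J].
Proof.
move=> f_inj dec gen_g gS Sg.
have conj_f q h : exists q', (f q) ^ h = f (q ^ q').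
  have [q' [w [-> wC]]] := dec h; exists q'.
  rewrite conjgM gmulfJ; apply/conjg_fixP/commgP/commute_sym; exact: wC.
have [N1 NM NV NJ] := normal_closure_normal S.
have f_S a : normal_closure S (f a).
  apply: (gen_g [set a | normal_closure S (f a)]) => /= [|x y Sx Sy|x Sx|i].
  - by rewrite gmulf1.
  - by rewrite gmulfM; apply: NM.
  - by rewrite gmulfV; apply: NV.
  - have [s [h [Ss ->]]] := gS i; apply: NJ.
    by move=> N [_]; apply.
have S_f x : normal_closure S x -> exists a, x = f a.
  move=> Sx; apply: (Sx [set x | exists a, x = f a]); split; last first.
    by move=> s /Sg[i ->]; exists (g i).
  split=> /= [|_ _ [p ->] [q ->]|_ [p ->]|_ h [p ->]].
  - by exists 1; rewrite gmulf1.
  - by exists (p * q); rewrite gmulfM.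
  - by exists p^-1; rewrite gmulfV.
  - by have [q ->] := conj_f p h; exists (p ^ q).
pose F := ncl_lift f_S.
have FE a : val (F a) = f a by apply: val_ncl_lift.
have F_inj : injective F by move=> p q /(congr1 val); rewrite !FE => /f_inj.
have F1 : F 1 = 1 by apply: val_inj; rewrite FE gmulf1 val1.
have F_surj t : exists a, F a = t.
  have [a ta] := S_f _ (set_mem (valP t)).
  by exists a; apply: val_inj; rewrite FE ta.
exists (ncl_lift f_S); split.
  have [F' F'K] := choice F_surj; exists F' => // a.
  by apply: F_inj; apply: F'K.
apply/seteqP; split=> [_ /= [a [a1 [_ [h [k [[x _ <-] aE]]]]] <-]|t [/= t1]].
  split=> [E|]; first by apply: a1; apply: F_inj; rewrite F1.
  have [s [h' [Ss fs]]] := gS x; exists s, (h' * f h), k; split=> //.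
  by rewrite FE aE gexpz_morph gmulfJ fs -conjgM gexpzJ.
move=> [s [h [k [Ss tE]]]]; have [x sE] := Sg _ Ss.
have [q xq] := conj_f (gexpz (g x) k) h.
have tF : F (gexpz (g x ^ q) k) = t.
  by apply: val_inj; rewrite FE gexpzJ -xq gexpz_morph -sE; apply: esym.
exists (gexpz (g x ^ q) k) => //; split; last by exists (g x), q, k; split=> //; exists x.
by move=> E; case: t1; rewrite -tF E F1.
Qed.

(** * Comparing the braid quotient with the J-group *)

Definition braid_rel (n m : nat) (K : (gcdn n m).-tuple exponent) (b c : exponent)
    (G : groupType) (g : Bgen n -> G) : Prop :=
  [/\ holds [set uv | @B_relation n m uv.1 uv.2] g,
      forall (i : 'I_n) (j : 'I_(gcdn n m)), i = j :> nat ->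
        killed (g (BX i)) (tnth K j),
      killed (g BY) b & killed (g BZ) c].

Section Comparison.
Variables n m : nat.
Hypotheses (n_gt0 : 0 < n) (m_gt0 : 0 < m).
Variables (K : (gcdn n m).-tuple exponent) (b c : exponent).

Local Notation d := (gcdn n m).
Local Notation n' := (n %/ d).
Local Notation m' := (m %/ d).
Local Notation KJ :=
  [tuple of K ++ [:: exponent_mul b n'; exponent_mul c m']].
Local Notation KJ' := [tuple of nseq d 1%N ++ [:: n'; m']].

Local Notation ix := (@lshift d 2).
Local Notation iu := (rshift d (ord0 : 'I_2)).
Local Notation iv := (rshift d (ord_max : 'I_2)).

Let d_gt0 : 0 < d. Proof. by rewrite gcdn_gt0 n_gt0. Qed.
Let nE : (n' * d)%N = n. Proof. by rewrite divnK ?dvdn_gcdl. Qed.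
Let mE : (m' * d)%N = m. Proof. by rewrite divnK ?dvdn_gcdr. Qed.

Let bezout : exists a b, (a * n' = (b * m').+1)%N.
Proof.
have n'_gt0 : 0 < n' by rewrite divn_gt0 ?d_gt0 // (dvdn_leq n_gt0 (dvdn_gcdl n m)).
case: (egcdnP m' n'_gt0) => a b' E _; exists a, b'; rewrite E -addn1; congr addn.
by apply/eqP; rewrite -(eqn_pmul2r d_gt0) muln_gcdl nE mE mul1n.
Qed.

Let n'_gt0 : 0 < n'.
Proof. by rewrite divn_gt0 ?d_gt0 // (dvdn_leq n_gt0 (dvdn_gcdl n m)). Qed.
Let m'_gt0 : 0 < m'.
Proof. by rewrite divn_gt0 ?d_gt0 // (dvdn_leq m_gt0 (dvdn_gcdr n m)). Qed.

Let d_le_n : d <= n.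
Proof. by rewrite dvdn_leq ?dvdn_gcdl. Qed.

Local Notation sseq g := (twist d_gt0 (fun i => g (ix i)) (g iu)).

Lemma J_prodE (G : groupType) (g : 'I_(d + 2) -> G) :
  \prod_(j <- enum 'I_(d + 2)) g j = pprod (sseq g) d * g iu * g iv.
Proof.
have -> : enum 'I_(d + 2) = index_enum _ by rewrite enumT [index_enum _]unlock.
rewrite big_split_ord /= !big_ord_recl big_ord0 /= mulg1 mulgA.
have -> : lift ord0 ord0 = ord_max :> 'I_2 by apply: val_inj.
congr (_ * _ * _); rewrite /pprod big_mkord; apply: eq_bigr => i _.
by rewrite twist_ord.
Qed.

Lemma tnth_KJ (T : Type) (t : d.-tuple T) (x y : T) (s := [tuple of t ++ [:: x; y]]) :
  [/\ forall i, tnth s (ix i) = tnth t i, tnth s iu = x & tnth s iv = y].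
Proof.
split=> [i||]; first by rewrite tnth_lshift.
  by rewrite tnth_rshift.
by rewrite tnth_rshift.
Qed.

Variant JGen_index_spec : 'I_(d + 2) -> Prop :=
  | JGen_index_s i : JGen_index_spec (ix i)
  | JGen_index_u : JGen_index_spec iu
  | JGen_index_v : JGen_index_spec iv.

Lemma JGen_indexP i : JGen_index_spec i.
Proof.
case: (split_ordP i) => j -> {i}; first exact: JGen_index_s.
have [->|->] : j = ord0 \/ j = ord_max.
- by case: j => [[|[|//]] ltj]; [left|right]; apply: val_inj.
- exact: JGen_index_u.
- exact: JGen_index_v.
Qed.

Lemma gJ_gensP (g : JGroup KJ) : gJ_gens KJ' g <->
  [\/ exists i, g = JGen KJ (ix i), g = JGen KJ iu ^+ n' | g = JGen KJ iv ^+ m'].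
Proof.
have [ex eu ev] := tnth_KJ [tuple of nseq d 1%N] n' m'.
split=> [[i ->]|[[i ->]|->|->]].
- case: (JGen_indexP i) => [j||].
  + by constructor 1; exists j; rewrite ex tnth_nseq.
  + by constructor 2; rewrite eu.
  + by constructor 3; rewrite ev.
- by exists (ix i); rewrite ex tnth_nseq.
- by exists iu; rewrite eu.
- by exists iv; rewrite ev.
Qed.

Lemma J_relKJ (G : groupType) (g : 'I_(d + 2) -> G) :
  J_rel KJ g <->
  (forall i, commute (pprod (sseq g) d * g iu * g iv) (g i)) /\
  [/\ forall i, killed (g (ix i)) (tnth K i), killed (g iu ^+ n') b
    & killed (g iv ^+ m') c].
Proof.
have [ex eu ev] := tnth_KJ K (exponent_mul b n') (exponent_mul c m').
rewrite /J_rel J_prodE; split=> [[gC gK]|[gC [kx ku kv]]]; split=> //.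
  split=> [i||]; first by rewrite -ex.
    by apply/killedX; rewrite -eu.
  by apply/killedX; rewrite -ev.
move=> i; case: (JGen_indexP i) => [j||]; rewrite ?ex // ?eu ?ev; exact/killedX.
Qed.

(** The images of the generators x_(i+1), y, z under the isomorphism; for i < d the
    first is the generator s_(i+1) itself. *)
Definition braid_in_J (G : groupType) (g : 'I_(d + 2) -> G) (a : Bgen n) : G :=
  match a with BX i => sseq g i | BY => g iu ^+ n' | BZ => g iv ^+ m' end.

Lemma braid_rel_of_J (G : groupType) (g : 'I_(d + 2) -> G) : J_rel KJ g ->
  braid_rel K b c (braid_in_J g).
Proof.
move=> /J_relKJ[gC [kx ku kv]]; set c0 := (_ * _ : G) in gC.
set x := sseq g.
have u_x : shifts d (g iu) x by apply: twist_shifts.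
have c_x i : commute c0 (x i).
  rewrite /x unlock; apply: commuteM.
    by rewrite invgK; apply: commuteX.
  by apply: commuteM => //; apply/commuteV/commuteX.
have [tE cty t_x] := frame_of_JGens n' m' u_x (gC _) (gC _) c_x.
split=> // [|i j ij].
  set h := braid_in_J g.
  have xE : x =1 twist n_gt0 (fun i => h (BX i)) (h BY).
    apply: twist_uniq => //; rewrite -[X in shifts X]nE; exact: shiftsX.
  apply/(braid_relsP (n_gt0 := n_gt0)); last split.
  - rewrite -(eq_pprod _ xE) -[X in pprod x X]mE; exact: tE.
  - exact: cty.
  - by move: t_x; rewrite mE => t_x k; rewrite -!xE.
by rewrite /= -/x ij /x twist_ord.
Qed.

Section Iso.
Variables (Q : groupType) (g : Bgen n -> Q).
Hypothesis Q_pres : presents (braid_rel K b c) g.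

Local Notation X := (twist n_gt0 (fun i => g (BX i)) (g BY)).
Local Notation y := (g BY).
Local Notation z := (g BZ).
Local Notation t := (z * pprod X m)^-1.
Local Notation zeta := (y ^+ m' * t ^- n').

Let t_frame : commute t y /\ shifts m t X.
Proof.
have [rels _ _ _] := presents_rel Q_pres.
exact/(braid_relsP (n_gt0 := n_gt0) (esym (invgK (z * pprod X m)))).
Qed.

(* y^m' and t^n' both shift by n m / d, so zeta fixes each X_i; it commutes with
   y and t, and z is expressed by t and the X_i. *)
Let zetaC a : commute zeta a.
Proof.
have [cty t_X] := t_frame.
have y_X : shifts n y X by apply: twist_shifts.
have cy : commute zeta y.
  apply/commute_sym/commuteM; first exact/commuteX/commute_refl.
  exact/commuteV/commuteX/commute_sym.
have ct : commute zeta t.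
  apply/commute_sym/commuteM; first exact: commuteX.
  exact/commuteV/commuteX/commute_refl.
have cX i : commute zeta (X i).
  have mn : (n' * m = m' * n)%N.
    by transitivity (n' * (m' * d))%N; [rewrite mE | rewrite mulnCA nE].
  have yV : y ^+ m' * t ^- n' = t ^- n' * y ^+ m'.
    exact/commuteV/commuteX2/commute_sym.
  have zX : shifts 0 (t ^- n' * y ^+ m') X.
    by apply: shiftsVM (shiftsX n' t_X) _; rewrite add0n mn; apply: shiftsX.
  by have := zX i; rewrite -yV addn0.
apply: (presents_gen Q_pres (P := [set a | commute zeta a])) => {a} /= [|a a'|a|[i||]].
- exact: commute1.
- exact: commuteM.
- exact: commuteV.
- by rewrite -(twist_ord n_gt0 (fun i => g (BX i)) y).
- exact: cy.
- rewrite [X in commute _ X](_ : z = t^-1 * (pprod X m)^-1); last by rewrite invgK mulgK.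
  apply: commuteM; apply: commuteV; first exact: ct.
  by apply: commute_prod => i _; apply: cX.
Qed.

Let J := JGroup KJ.

Lemma braid_to_J : exists f : ghom Q J, forall a, f (g a) = braid_in_J (JGen KJ) a.
Proof.
have [f fE] := presents_lift Q_pres (braid_rel_of_J (presents_rel (J_presents KJ))).
by exists f.
Qed.

(** The map is inverted in the enlargement of Q by a central root c0 of zeta. *)
Lemma braid_to_J_inj (f : ghom Q J) :
  (forall a, f (g a) = braid_in_J (JGen KJ) a) -> injective f.
Proof.
move=> fE; have [cty t_X] := t_frame.
have y_X : shifts n y X by apply: twist_shifts.
have [_ kx ky kz] := presents_rel Q_pres.
have L_gt0 : (0 < n' * m')%N by rewrite muln_gt0 n'_gt0 m'_gt0.
(* c0 plays the role of the central product of the generators of J. *)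
have [E [incl [c0 [incl_inj c0C c0E]]]] := adjoin_central_root L_gt0 zetaC.
have [alpha [beta bez]] := bezout.
pose X' i := incl (X i).
have y_X' : shifts (n' * d) (incl y) X'.
  by move=> i; rewrite /X' -gmulfM nE y_X gmulfM.
have t_X' : shifts (m' * d) (incl t) X'.
  by move=> i; rewrite /X' -gmulfM mE t_X gmulfM.
have tE : incl z * pprod X' (m' * d) = (incl t)^-1.
  by rewrite mE -pprod_morph -gmulfM gmulfV invgK.
have cty' : commute (incl t) (incl y) by rewrite /commute -!gmulfM cty.
have c0E' : c0 ^+ (n' * m') = incl y ^+ m' * incl t ^- n'.
  by rewrite c0E gmulfM gmulfXVn gmulfXn.
have [] := JGens_of_frame bez y_X' t_X' tE cty' (c0C _) (c0C _) (fun i => c0C _) c0E'.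
set u := (_ * _); set v := (_ * c0) => u_X un _ vm.
pose h (k : 'I_(d + 2)) : E := match split k with
  | inl i => X' i | inr j => if j == ord0 then u else v end.
have hx i : h (ix i) = X' i by rewrite /h -[ix i]/(unsplit (inl i)) unsplitK.
have hu : h iu = u by rewrite /h -[iu]/(unsplit (inr ord0)) unsplitK.
have hv : h iv = v by rewrite /h -[iv]/(unsplit (inr ord_max)) unsplitK.
have sE : sseq h =1 X'.
  move=> i; apply: esym; move: i; apply: twist_uniq => [|i]; first by rewrite hu.
  by rewrite hx.
have hJ : J_rel KJ h.
  apply/J_relKJ; rewrite (eq_pprod d sE) hu hv mulVKg un vm; split=> //.
  split=> [i||]; try exact: killed_morph.
  have X_i : X i = g (BX (widen_ord d_le_n i)).
    by rewrite -(twist_ord n_gt0 (fun i => g (BX i)) y).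
  by rewrite hx /X' X_i; apply: killed_morph; apply: kx.
have [r rE] := presents_lift (J_presents KJ) hJ.
have rf : r \o f =1 incl.
  apply: (generates_eq (f := r \o f) (f' := incl) (presents_gen Q_pres)) => a /=.
  rewrite fE; case: a => [i||] /=.
  - rewrite twist_morph rE; under [fun _ => _]funext => k do rewrite rE.
    by rewrite sE /X' twist_ord.
  - by rewrite gmulfXn rE hu un.
  - by rewrite gmulfXn rE hv vm.
by move=> p q /(congr1 r); rewrite -![r _]/((r \o f) _) !rf => /incl_inj.
Qed.

(** The central factors are the powers of c0: since u^m' c0^-m' = f t, the Bezout
    relation expresses u through f y, f t and c0, and then v = (P d u)^-1 c0. *)
Lemma J_decomp (f : ghom Q J) :
  (forall a, f (g a) = braid_in_J (JGen KJ) a) ->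
  forall h, exists q w, h = f q * w /\ forall x, commute w x.
Proof.
move=> fE; pose S := sseq (JGen KJ); pose u := JGen KJ iu; pose v := JGen KJ iv.
pose c0 := pprod S d * u * v.
have [gC _] := (J_relKJ _).1 (presents_rel (J_presents KJ)).
have c0C x : commute c0 x.
  apply: (presents_gen (J_presents KJ) (P := [set x | commute c0 x])) => {x} /=.
  - exact: commute1.
  - by move=> x x'; apply: commuteM.
  - by move=> x; apply: commuteV.
  - exact: gC.
have u_S : shifts d u S by apply: twist_shifts.
have fX : (fun i => f (X i)) =1 S.
  move=> i; rewrite twist_morph; apply: esym; move: i; apply: twist_uniq => [|i].
    by rewrite fE -[X in shifts X]nE; apply: shiftsX.
  by rewrite fE.
have [tE _ _] := frame_of_JGens n' m' u_S (c0C _) (c0C _) (fun i => c0C _).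
have ft : f t = u ^+ m' * c0 ^- m'.
  rewrite gmulfV gmulfM fE pprod_morph (eq_pprod m fX) -[X in pprod S X]mE.
  by apply: invg_inj; rewrite invgK.
pose P : set J := [set h | exists q w, h = f q * w /\ forall x, commute w x].
have PM x x' : P x -> P x' -> P (x * x').
  move=> [q [w [-> wC]]] [q' [w' [-> w'C]]]; exists (q * q'), (w * w').
  split; first by rewrite gmulfM !mulgA -[f q * w * _]mulgA wC !mulgA.
  by move=> x0; apply/commute_sym/commuteM; apply: commute_sym.
have PV x : P x -> P x^-1.
  move=> [q [w [-> wC]]]; exists q^-1, w^-1.
  split; first by rewrite -wC invgM gmulfV.
  by move=> x0; apply/commute_sym/commuteV/commute_sym.
have Pf q : P (f q).
  by exists q, 1; rewrite mulg1; split=> // x; apply/commute_sym/commute1.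
have P1 : P 1 by rewrite -(gmulf1 (s := f)).
have Pc : P c0 by exists 1, c0; rewrite gmulf1 mul1g.
have PX x k : P x -> P (x ^+ k).
  move=> Px; elim: k => [|k IHk]; first exact: P1.
  by rewrite expgS; apply: PM.
have Pu : P u.
  have [a [b' bez]] := bezout.
  have -> : u = f y ^+ a * (f t * c0 ^+ m') ^- b'.
    by rewrite ft fE mulgVK -!expgnA (mulnC n') bez expgS (mulnC m') mulgK.
  exact: PM (PX _ _ (Pf y)) (PV _ (PX _ _ (PM _ _ (Pf _) (PX _ _ Pc)))).
apply: (presents_gen (J_presents KJ)) => //.
move=> i; case: (JGen_indexP i) => [j||] //.
  have -> : JGen KJ (ix j) = f (g (BX (widen_ord d_le_n j))) by rewrite fE /= twist_ord.
  exact: Pf.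
have -> : JGen KJ iv = (pprod S d * u)^-1 * c0 by rewrite mulKg.
have PS : P (pprod S d) by rewrite -(eq_pprod d fX) -pprod_morph; apply: Pf.
exact: PM (PV _ (PM _ _ PS Pu)) Pc.
Qed.

Lemma braid_ref_isomorphic :
  ref_isomorphic (tors_reflections [set g a | a in setT]) (@gJ_reflections _ KJ KJ').
Proof.
have [f fE] := braid_to_J.
apply: (ref_isomorphic_ncl (f := f)).
- exact: braid_to_J_inj.
- exact: J_decomp.
- exact: presents_gen Q_pres.
- case=> [i||]; rewrite fE /=.
  + exists (JGen KJ (ix (Ordinal (ltn_pmod i d_gt0)))), (JGen KJ iu ^- (i %/ d)).
    split; last by rewrite unlock.
    by apply/gJ_gensP; constructor 1; exists (Ordinal (ltn_pmod i d_gt0)).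
  + exists (JGen KJ iu ^+ n'), 1; rewrite conjg1; split=> //.
    by apply/gJ_gensP; constructor 2.
  + exists (JGen KJ iv ^+ m'), 1; rewrite conjg1; split=> //.
    by apply/gJ_gensP; constructor 3.
- move=> _ /gJ_gensP[[i ->]|->|->].
  + by exists (BX (widen_ord d_le_n i)); rewrite fE /= twist_ord.
  + by exists BY; rewrite fE.
  + by exists BZ; rewrite fE.
Qed.

End Iso.

End Comparison.

(** * The four torsion quotients *)

Lemma tors_reflections_drop1 (G : groupType) (X X' : set G) :
    X `<=` X' -> (forall x, X' x -> X x \/ x = 1) ->
  tors_reflections X = tors_reflections X'.
Proof.
move=> XX' X'X; apply/seteqP; split=> t [t1 [s [h [k [Xs tE]]]]]; split=> //.
  by exists s, h, k; split=> //; apply: XX'.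
have [Xs'|s1] := X'X _ Xs; first by exists s, h, k.
case: t1; rewrite tE s1 conj1g.
by case: k {tE} => k /=; rewrite expg1n ?invg1.
Qed.

Lemma holds_morph (A : choiceType) (R : set (free_group A * free_group A))
    (G H : groupType) (f : ghom G H) (g : A -> G) :
  holds R g -> holds R (fun a => f (g a)).
Proof.
move=> Rg [u v] /Rg /= E.
have fE := generates_eq (f := free_eval (fun a => f (g a)))
  (f' := f \o free_eval g) (@free_gen_generates A).
by rewrite !fE /= ?E // => a; rewrite free_eval_gen /= free_eval_gen.
Qed.

Lemma torsion_ker (G H : groupType) (f : ghom G H) x k :
  killed (f x) k <-> forall t, torsion x k t -> f t = 1.
Proof.
split=> [fx t [j kj ->]|ft j kj]; first by rewrite gmulfXn fx.
by rewrite -gmulfXn ft //; exists j.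
Qed.

Section BraidPresentations.
Variables (n m : nat).

Local Notation R := (holds [set uv | @B_relation n m uv.1 uv.2]).

Lemma Bss_presents : presents R (@Bss_gen n m).
Proof. exact: presented_presents. Qed.

Lemma Bup_presents :
  presents (fun G g => R g /\ g BY = 1) (@Bup_gen n m).
Proof.
apply: (quo_presents Bss_presents) => [G f|G h []//].
split=> [[_ fy] s ->//|fy]; split; last exact: fy.
exact: (holds_morph f (presents_rel Bss_presents)).
Qed.

Lemma Blo_presents :
  presents (fun G g => R g /\ g BZ = 1) (@Blo_gen n m).
Proof.
apply: (quo_presents Bss_presents) => [G f|G h []//].
split=> [[_ fz] s ->//|fz]; split; last exact: fz.
exact: (holds_morph f (presents_rel Bss_presents)).
Qed.

Lemma Bnn_presents :
  presents (fun G g => R g /\ g BY = 1 /\ g BZ = 1) (@Bnn_gen n m).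
Proof.
apply: (quo_presents Bss_presents) => [G f|G h []//].
split=> [[_ [fy fz]] s [->|->]//|fyz].
split; first exact: (holds_morph f (presents_rel Bss_presents)).
by split; apply: fyz; [left|right].
Qed.

Variables (K : (gcdn n m).-tuple exponent) (b c : exponent).

Lemma x_torsion_ker (G H : groupType) (g : Bgen n -> G) (f : ghom G H) :
  (forall (i : 'I_n) (j : 'I_(gcdn n m)), i = j :> nat ->
      killed (f (g (BX i))) (tnth K j)) <->
  forall t, x_torsion K g t -> f t = 1.
Proof.
split=> [kx t [i [j [ij gt]]]|ft i j ij].
  exact: (torsion_ker _ _ _).1 (kx i j ij) _ gt.
by apply/torsion_ker => t gt; apply: ft; exists i, j.
Qed.

Lemma Bss_tors_presents :
  presents (braid_rel K b c) (fun a => quo_proj _ (Bss_gen m a) : Bss_tors K b c).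
Proof.
apply: (quo_presents Bss_presents) => [G f|G h []//]; split.
  move=> [_ kx ky kz] t [[|]|];
    by [move: t; apply/x_torsion_ker|move: t; apply/torsion_ker].
move=> ft; split.
- exact: (holds_morph f (presents_rel Bss_presents)).
- by apply/(x_torsion_ker (@Bss_gen n m)) => t xt; apply: ft; left; left.
- by apply/torsion_ker => t yt; apply: ft; left; right.
- by apply/torsion_ker => t zt; apply: ft; right.
Qed.

Lemma Bup_tors_presents :
  presents (braid_rel K (Some 1%N) c) (fun a => quo_proj _ (Bup_gen m a) : Bup_tors K c).
Proof.
apply: (quo_presents Bup_presents) => [G f|G h [? _ /killed1]//]; split.
  move=> [_ kx _ kz] t []; by [move: t; apply/x_torsion_ker|move: t; apply/torsion_ker].
have [Rg y1] := presents_rel Bup_presents.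
move=> ft; split.
- exact: (holds_morph f Rg).
- by apply/(x_torsion_ker (@Bup_gen n m)) => t xt; apply: ft; left.
- by apply/killed1; rewrite y1 gmulf1.
- by apply/torsion_ker => t zt; apply: ft; right.
Qed.

Lemma Blo_tors_presents :
  presents (braid_rel K b (Some 1%N)) (fun a => quo_proj _ (Blo_gen m a) : Blo_tors K b).
Proof.
apply: (quo_presents Blo_presents) => [G f|G h [? _ _ /killed1]//]; split.
  move=> [_ kx ky _] t []; by [move: t; apply/x_torsion_ker|move: t; apply/torsion_ker].
have [Rg z1] := presents_rel Blo_presents.
move=> ft; split.
- exact: (holds_morph f Rg).
- by apply/(x_torsion_ker (@Blo_gen n m)) => t xt; apply: ft; left.
- by apply/torsion_ker => t zt; apply: ft; right.
- by apply/killed1; rewrite z1 gmulf1.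
Qed.

Lemma Bnn_tors_presents :
  presents (braid_rel K (Some 1%N) (Some 1%N))
    (fun a => quo_proj _ (Bnn_gen m a) : Bnn_tors K).
Proof.
apply: (quo_presents Bnn_presents) => [G f|G h [? _ /killed1 ? /killed1]//]; split.
  by move=> [_ kx _ _]; apply/x_torsion_ker.
have [Rg [y1 z1]] := presents_rel Bnn_presents.
move=> ft; split.
- exact: (holds_morph f Rg).
- by apply/(x_torsion_ker (@Bnn_gen n m)) => t xt; apply: ft.
- by apply/killed1; rewrite y1 gmulf1.
- by apply/killed1; rewrite z1 gmulf1.
Qed.

Lemma Bup_reflectionsE : @Bup_reflections n m K c =
  tors_reflections [set quo_proj _ (Bup_gen m a) | a in setT].
Proof.
apply: tors_reflections_drop1 => [_ [a _ <-]|_ [[i||] _ <-]]; first by exists a.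
- by left; exists (BX i) => //; left; exists i.
- by right; rewrite (presents_rel Bup_presents).2 gmulf1.
- by left; exists BZ => //; right.
Qed.

Lemma Blo_reflectionsE : @Blo_reflections n m K b =
  tors_reflections [set quo_proj _ (Blo_gen m a) | a in setT].
Proof.
apply: tors_reflections_drop1 => [_ [a _ <-]|_ [[i||] _ <-]]; first by exists a.
- by left; exists (BX i) => //; left; exists i.
- by left; exists BY => //; right.
- by right; rewrite (presents_rel Blo_presents).2 gmulf1.
Qed.

Lemma Bnn_reflectionsE : @Bnn_reflections n m K =
  tors_reflections [set quo_proj _ (Bnn_gen m a) | a in setT].
Proof.
have [_ [y1 z1]] := presents_rel Bnn_presents.
apply: tors_reflections_drop1 => [_ [a _ <-]|_ [[i||] _ <-]]; first by exists a.
- by left; exists (BX i) => //; exists i.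
- by right; rewrite y1 gmulf1.
- by right; rewrite z1 gmulf1.
Qed.

End BraidPresentations.

Local Close Scope group_scope.
Local Close Scope quotient_scope.
Local Close Scope classical_set_scope.

Theorem theorem1p7 (n m : nat) (n_gt0 : 0 < n) (m_gt0 : 0 < m)
    (K : (gcdn n m).-tuple exponent) (b c : exponent)
    (hK : forall i, exponent_ge 2 (tnth K i))
    (hb : exponent_ge 2 b) (hc : exponent_ge 2 c) :
  let d := gcdn n m in
  let n' := n %/ d in
  let m' := m %/ d in
  let row1 (u v : exponent) := [tuple of K ++ [:: u; v]] in
  let row2 := [tuple of nseq d 1 ++ [:: n'; m']] in
  let bn' := exponent_mul b n' in
  let cm' := exponent_mul c m' in
  [/\ ref_isomorphic (@Bss_reflections n m K b c)
        (@gJ_reflections (d + 2) (row1 bn' cm') row2),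
      ref_isomorphic (@Bup_reflections n m K c)
        (@gJ_reflections (d + 2) (row1 (Some n') cm') row2),
      ref_isomorphic (@Blo_reflections n m K b)
        (@gJ_reflections (d + 2) (row1 bn' (Some m')) row2)
    & ref_isomorphic (@Bnn_reflections n m K)
        (@gJ_reflections (d + 2) (row1 (Some n') (Some m')) row2)].
Proof.
move=> d n' m' row1 row2 bn' cm'.
have mul1 k : Some k = exponent_mul (Some 1%N) k by rewrite /= mul1n.
rewrite Bup_reflectionsE Blo_reflectionsE Bnn_reflectionsE (mul1 n') (mul1 m').
split; apply: braid_ref_isomorphic => //.
- exact: Bss_tors_presents.
- exact: Bup_tors_presents.
- exact: Blo_tors_presents.
- exact: Bnn_tors_presents.
Qed.
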